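(* Let $(\mathbb{X},\alpha:\mathbb{X}\to\mathsf{CAct}(\mathbb{X}))$ be a change action model, and let $\mathsf{Flat}_\alpha$ be the subcategory of $\mathbb{X}$ consisting of all flat objects and all flat maps between them. Then $\mathsf{Flat}_\alpha$ is a Cartesian difference category, with the Cartesian structure of $\mathbb{X}$ and with the following structure for maps $f,g:A\to B$ in $\mathsf{Flat}_\alpha$: sum $f+g=+_B\circ\langle f,g\rangle$; zero map $0=0_B\circ !_A$; infinitesimal extension $\varepsilon(f)=\oplus_B\circ\langle 0_B\circ !_A,f\rangle$; and difference combinator $\boldsymbol\partial[f]$ defined as the second component of $\alpha(f)=(f,\boldsymbol\partial[f])$.
   Context: Composition is written $g\circ f$ (first $f$, then $g$). A Cartesian category is a category with chosen finite products: binary products $A\times B$ with projections $\pi_0,\pi_1$, pairing $\langle -,-\rangle$, $f\times g=\langle f\circ\pi_0,g\circ\pi_1\rangle$, and terminal object $\top$ with unique maps $!_A:A\to\top$. A change action in a Cartesian category $\mathbb{X}$ is a quintuple $(A,\Delta A,\oplus_A,+_A,0_A)$ with objects $A,\Delta A$ and maps $\oplus_A:A\times\Delta A\to A$, $+_A:\Delta A\times\Delta A\to\Delta A$, $0_A:\top\to\Delta A$ such that $(\Delta A,+_A,0_A)$ is an internal monoid (not necessarily commutative) and $\oplus_A$ is an action of it on $A$: $\oplus_A\circ\langle 1_A,0_A\circ !_A\rangle=1_A$ and $\oplus_A\circ(1_A\times +_A)=\oplus_A\circ\langle\oplus_A\circ(1_A\times\pi_0),\pi_1\circ\pi_1\rangle$.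 For maps write $f\oplus_A g=\oplus_A\circ\langle f,g\rangle$ and $h+_A k=+_A\circ\langle h,k\rangle$. Given change actions on $A$ and $B$, a derivative of $f:A\to B$ is a map $\boldsymbol\partial[f]:A\times\Delta A\to\Delta B$ such that for all $x:C\to A$ and $y,z:C\to\Delta A$: [CAD.1] $f\circ(x\oplus_A y)=(f\circ x)\oplus_B(\boldsymbol\partial[f]\circ\langle x,y\rangle)$; [CAD.2] $\boldsymbol\partial[f]\circ\langle x,y+_A z\rangle=(\boldsymbol\partial[f]\circ\langle x,y\rangle)+_B(\boldsymbol\partial[f]\circ\langle x\oplus_A y,z\rangle)$ and $\boldsymbol\partial[f]\circ\langle x,0_A\circ !_C\rangle=0_B\circ !_C$. $\mathsf{CAct}(\mathbb{X})$ is the category whose objects are change actions in $\mathbb{X}$ and whose maps are pairs $(f,\boldsymbol\partial[f])$ with $\boldsymbol\partial[f]$ a derivative of $f$; the identity is $(1_A,\pi_1)$ and $(g,\boldsymbol\partial[g])\circ(f,\boldsymbol\partial[f])=(g\circ f,\boldsymbol\partial[g]\circ\langle f\circ\pi_0,\boldsymbol\partial[f]\rangle)$. It is Cartesian: the product of two change actions has underlying objects $A\times B$ and $\Delta A\times\Delta B$ with componentwise structure, projections $(\pi_i,\pi_i\circ\pi_1)$, and pairing $(\langle f,g\rangle,\langle\boldsymbol\partial[f],\boldsymbol\partial[g]\rangle)$; the terminal object has both underlying objects $\top$. The forgetful functor $\mathcal{E}:\mathsf{CAct}(\mathbb{X})\to\mathbb{X}$ sends a change action to $A$ and $(f,\boldsymbol\partial[f])$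 to $f$. A change action model is a Cartesian category $\mathbb{X}$ with a functor $\alpha:\mathbb{X}\to\mathsf{CAct}(\mathbb{X})$ that preserves the chosen finite products and satisfies $\mathcal{E}\circ\alpha=1_{\mathbb{X}}$. Write $\alpha(A)=(A,\Delta A,\oplus_A,+_A,0_A)$ and $\alpha(f)=(f,\boldsymbol\partial[f])$. An object $A$ of a change action model is flat if: [F.1] $\Delta A=A$; [F.2] $\alpha(\oplus_A)=(\oplus_A,\oplus_A\circ\pi_1)$ and $\alpha(+_A)=(+_A,+_A\circ\pi_1)$; [F.3] $\oplus_A$ is right-injective: $\oplus_A\circ\langle f,g\rangle=\oplus_A\circ\langle f,h\rangle$ implies $g=h$. A map $f:A\to B$ between flat objects is flat if: [F.4] for all $x,y:C\to A$, $(0_B\circ !_C)\oplus_B(\boldsymbol\partial[f]\circ\langle x,y\rangle)=\boldsymbol\partial[f]\circ\langle x,(0_A\circ !_C)\oplus_A y\rangle$. A left additive category is a category in which each hom-set is a commutative monoid $(+,0)$ with $(f+g)\circ h=f\circ h+g\circ h$ and $0\circ f=0$. A map $k$ is additive if $k\circ(f+g)=k\circ f+k\circ g$ and $k\circ 0=0$. A Cartesian left additive category is a Cartesian category that is also left additive and whose projections are all additive. An infinitesimal extension $\varepsilon$ on a Cartesian left additive category $\mathbb{Y}$ consists of functions $\varepsilon:\mathbb{Y}(A,B)\to\mathbb{Y}(A,B)$ for all $A,B$ such that [E.1] $\varepsilon(f+g)=\varepsilon(f)+\varepsilon(g)$, $\varepsilon(0)=0$; [E.2] $\varepsilon(g\circ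 f)=\varepsilon(g)\circ f$; [E.3] $\varepsilon(\pi_i)=\pi_i\circ\varepsilon(1_{A\times B})$ for $i=0,1$. A Cartesian difference category is a Cartesian left additive category with an infinitesimal extension $\varepsilon$ and a difference combinator $\boldsymbol\partial$, assigning to each $f:A\to B$ a map $\boldsymbol\partial[f]:A\times A\to B$, such that (for all suitable maps): [C∂.0] $f\circ(x+\varepsilon(y))=f\circ x+\varepsilon(\boldsymbol\partial[f]\circ\langle x,y\rangle)$; [C∂.1] $\boldsymbol\partial[f+g]=\boldsymbol\partial[f]+\boldsymbol\partial[g]$, $\boldsymbol\partial[0]=0$, $\boldsymbol\partial[\varepsilon(f)]=\varepsilon(\boldsymbol\partial[f])$; [C∂.2] $\boldsymbol\partial[f]\circ\langle x,y+z\rangle=\boldsymbol\partial[f]\circ\langle x,y\rangle+\boldsymbol\partial[f]\circ\langle x+\varepsilon(y),z\rangle$, $\boldsymbol\partial[f]\circ\langle x,0\rangle=0$; [C∂.3] $\boldsymbol\partial[1_A]=\pi_1$, $\boldsymbol\partial[\pi_0]=\pi_0\circ\pi_1$, $\boldsymbol\partial[\pi_1]=\pi_1\circ\pi_1$; [C∂.4] $\boldsymbol\partial[\langle f,g\rangle]=\langle\boldsymbol\partial[f],\boldsymbol\partial[g]\rangle$; [C∂.5] $\boldsymbol\partial[g\circ f]=\boldsymbol\partial[g]\circ\langle f\circ\pi_0,\boldsymbol\partial[f]\rangle$; [C∂.6] $\boldsymbol\partial[\boldsymbol\partial[f]]\circ\langle\langle x,y\rangle,\langle 0,z\rangle\rangle=\boldsymbol\partial[f]\circ\langle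 x+\varepsilon(y),z\rangle$; [C∂.7] $\boldsymbol\partial[\boldsymbol\partial[f]]\circ\langle\langle x,y\rangle,\langle z,0\rangle\rangle=\boldsymbol\partial[\boldsymbol\partial[f]]\circ\langle\langle x,z\rangle,\langle y,0\rangle\rangle$. *)

(* Defs.v *)
From Stdlib Require Import ssreflect ProofIrrelevance.

Set Implicit Arguments.
Unset Strict Implicit.
Unset Printing Implicit Defensive.

Declare Scope cat_scope.
Delimit Scope cat_scope with cat.
Local Open Scope cat_scope.

Record category := Category {
  ob :> Type;
  hom : ob -> ob -> Type;
  idm : forall A, hom A A;
  comp : forall A B C, hom B C -> hom A B -> hom A C;
  comp_assoc : forall A B C D (h : hom C D) (g : hom B C) (f : hom A B),
    comp h (comp g f) = comp (comp h g) f;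
  comp_id_l : forall A B (f : hom A B), comp (idm B) f = f;
  comp_id_r : forall A B (f : hom A B), comp f (idm A) = f }.

Arguments hom {c} A B.
Arguments idm {c} A.
Arguments comp {c A B C} g f : rename.

Notation "g \o f" := (comp g f) (at level 50, left associativity) : cat_scope.

(* Equality of arrows whose domains and codomains are only propositionally
   equal.  It is used wherever the mathematics asserts an equality of maps along
   a strict equality of objects. *)
Inductive arr_eq {X : category} {A B : X} (f : hom A B) :
  forall A' B' : X, hom A' B' -> Prop :=
| arr_refl : arr_eq f f.

Definition hom_cast {X : category} {A A' B B' : X} (eA : A = A') (eB : B = B')
    (f : hom A B) : hom A' B' :=
  match eA in _ = a, eB in _ = b return hom a b with
  | eq_refl, eq_refl => f
  end.

Record functor (X Y : category) := Functor {
  fob :> X -> Y;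
  fmap : forall A B : X, hom A B -> hom (fob A) (fob B);
  fmap_id : forall A : X, fmap (idm A) = idm (fob A);
  fmap_comp : forall (A B C : X) (g : hom B C) (f : hom A B),
    fmap (g \o f) = fmap g \o fmap f }.

Arguments fmap {X Y} f {A B} _ : rename.

Definition id_functor (X : category) : functor X X :=
  @Functor X X (fun A => A) (fun A B f => f)
    (fun A => eq_refl) (fun A B C g f => eq_refl).

Lemma comp_functor_id (X Y Z : category) (G : functor Y Z) (F : functor X Y)
    (A : X) : fmap G (fmap F (idm A)) = idm (G (F A)).
Proof. by rewrite !fmap_id. Qed.

Lemma comp_functor_comp (X Y Z : category) (G : functor Y Z) (F : functor X Y)
    (A B C : X) (g : hom B C) (f : hom A B) :
  fmap G (fmap F (g \o f)) = fmap G (fmap F g) \o fmap G (fmap F f).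
Proof. by rewrite !fmap_comp. Qed.

Definition comp_functor (X Y Z : category) (G : functor Y Z) (F : functor X Y) :
    functor X Z :=
  @Functor X Z (fun A => G (F A)) (fun A B f => fmap G (fmap F f))
    (comp_functor_id G F) (@comp_functor_comp X Y Z G F).

Record functor_eq (X Y : category) (F G : functor X Y) : Prop := FunctorEq {
  functor_eq_ob : forall A : X, F A = G A;
  functor_eq_map : forall (A B : X) (f : hom A B), arr_eq (fmap F f) (fmap G f) }.

Class cartesian (X : category) := Cartesian {
  prodo : X -> X -> X;
  proj0 : forall A B, hom (prodo A B) A;
  proj1 : forall A B, hom (prodo A B) B;
  pairm : forall C A B, hom C A -> hom C B -> hom C (prodo A B);
  proj0_pair : forall C A B (f : hom C A) (g : hom C B),
    proj0 A B \o pairm f g = f;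
  proj1_pair : forall C A B (f : hom C A) (g : hom C B),
    proj1 A B \o pairm f g = g;
  pair_unique : forall C A B (h : hom C (prodo A B)),
    h = pairm (proj0 A B \o h) (proj1 A B \o h);
  termo : X;
  bang : forall A, hom A termo;
  bang_unique : forall A (h : hom A termo), h = bang A }.

Arguments proj0 {X _} A B : rename.
Arguments proj1 {X _} A B : rename.
Arguments pairm {X _ C A B} f g : rename.
Arguments bang {X _} A : rename.

Notation "A ** B" := (prodo A B) (at level 40, left associativity) : cat_scope.
Notation "<| f , g |>" := (pairm f g)
  (at level 0, f at level 99, g at level 99, format "<| f ,  g |>") : cat_scope.

Definition prodm {X : category} {T : cartesian X} {A B C D : X}
    (f : hom A C) (g : hom B D) : hom (A ** B) (C ** D) :=
  <|f \o proj0 A B, g \o proj1 A B|>.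

Notation "f >< g" := (prodm f g) (at level 40, left associativity) : cat_scope.

(* Pairings and the maps [bang] are then preserved too, by uniqueness. *)
Record preserves_products (X Y : category) (TX : cartesian X) (TY : cartesian Y)
    (F : functor X Y) : Prop := PreservesProducts {
  preserves_prodo : forall A B : X, F (A ** B) = F A ** F B;
  preserves_proj0 : forall A B : X, arr_eq (fmap F (proj0 A B)) (proj0 (F A) (F B));
  preserves_proj1 : forall A B : X, arr_eq (fmap F (proj1 A B)) (proj1 (F A) (F B));
  preserves_termo : F termo = termo }.

Lemma pair_comp (X : category) (T : cartesian X) (D C A B : X)
    (f : hom C A) (g : hom C B) (h : hom D C) :
  <|f, g|> \o h = <|f \o h, g \o h|>.
Proof. by rewrite [LHS]pair_unique !comp_assoc proj0_pair proj1_pair. Qed.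

Lemma proj0_pairA (X : category) (T : cartesian X) (D C A B : X)
    (f : hom C A) (g : hom C B) (h : hom D C) :
  proj0 A B \o (<|f, g|> \o h) = f \o h.
Proof. by rewrite comp_assoc proj0_pair. Qed.

Lemma proj1_pairA (X : category) (T : cartesian X) (D C A B : X)
    (f : hom C A) (g : hom C B) (h : hom D C) :
  proj1 A B \o (<|f, g|> \o h) = g \o h.
Proof. by rewrite comp_assoc proj1_pair. Qed.

Lemma pair_ext (X : category) (T : cartesian X) (C A B : X)
    (h k : hom C (A ** B)) :
  proj0 A B \o h = proj0 A B \o k -> proj1 A B \o h = proj1 A B \o k -> h = k.
Proof. by move=> e0 e1; rewrite (pair_unique h) e0 e1 -pair_unique. Qed.

Lemma bang_eq (X : category) (T : cartesian X) (A : X) (h k : hom A termo) : h = k.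
Proof. by rewrite (bang_unique h) (bang_unique k). Qed.

Lemma bang_comp (X : category) (T : cartesian X) (A B : X) (h : hom A B) :
  bang B \o h = bang A.
Proof. exact: bang_eq. Qed.

Ltac cat_norm :=
  rewrite /prodm -?comp_assoc
    ?(pair_comp, proj0_pair, proj1_pair, proj0_pairA, proj1_pairA,
      comp_id_l, comp_id_r, bang_comp) -?comp_assoc.
Ltac cat_simp := repeat progress cat_norm.

Record change_action (X : category) {T : cartesian X} := ChangeAction {
  base : X;
  delta : X;
  oplus : hom (base ** delta) base;
  plus : hom (delta ** delta) delta;
  zero : hom termo delta;
  plus_0l : plus \o <|zero \o bang delta, idm delta|> = idm delta;
  plus_0r : plus \o <|idm delta, zero \o bang delta|> = idm delta;
  plus_assoc : plus \o (idm delta >< plus)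
    = plus \o <|plus \o (idm delta >< proj0 delta delta),
                proj1 delta delta \o proj1 delta (delta ** delta)|>;
  oplus_0 : oplus \o <|idm base, zero \o bang base|> = idm base;
  oplus_plus : oplus \o (idm base >< plus)
    = oplus \o <|oplus \o (idm base >< proj0 delta delta),
                 proj1 delta delta \o proj1 base (delta ** delta)|> }.

Arguments change_action X {T}.
Arguments oplus {X T} c.
Arguments plus {X T} c.
Arguments zero {X T} c.

Record is_derivative (X : category) {T : cartesian X} (A B : change_action X)
    (f : hom (base A) (base B)) (d : hom (base A ** delta A) (delta B)) : Prop :=
  IsDerivative {
  CAD1 : forall (C : X) (x : hom C (base A)) (y : hom C (delta A)),
    f \o (oplus A \o <|x, y|>) = oplus B \o <|f \o x, d \o <|x, y|> |>;
  CAD2_plus : forall (C : X) (x : hom C (base A)) (y z : hom C (delta A)),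
    d \o <|x, plus A \o <|y, z|> |>
    = plus B \o <|d \o <|x, y|>, d \o <|oplus A \o <|x, y|>, z|> |>;
  CAD2_zero : forall (C : X) (x : hom C (base A)),
    d \o <|x, zero A \o bang C|> = zero B \o bang C }.

Record cact_hom (X : category) {T : cartesian X} (A B : change_action X) :=
  CActHom {
  cact_map : hom (base A) (base B);
  cact_der : hom (base A ** delta A) (delta B);
  cact_derP : is_derivative cact_map cact_der }.

Lemma cact_hom_eq (X : category) (T : cartesian X) (A B : change_action X)
    (f g : cact_hom A B) :
  cact_map f = cact_map g -> cact_der f = cact_der g -> f = g.
Proof.
case: f g => [f df Hf] [g dg Hg] /= e0 e1; subst g dg.
by rewrite (proof_irrelevance _ Hf Hg).
Qed.

Lemma cact_id_derP (X : category) (T : cartesian X) (A : change_action X) :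
  is_derivative (A := A) (B := A) (idm (base A)) (proj1 (base A) (delta A)).
Proof. by split=> *; cat_simp. Qed.

Definition cact_id (X : category) (T : cartesian X) (A : change_action X) :
  cact_hom A A := CActHom (cact_id_derP A).

Lemma cact_comp_derP (X : category) (T : cartesian X) (A B C : change_action X)
    (g : cact_hom B C) (f : cact_hom A B) :
  is_derivative (A := A) (B := C) (cact_map g \o cact_map f)
    (cact_der g \o <|cact_map f \o proj0 (base A) (delta A), cact_der f|>).
Proof.
case: f g => [f df [f1 f2 f3]] [g dg [g1 g2 g3]] /=.
split=> [D x y|D x y z|D x]; cat_simp.
- by rewrite f1 g1.
- by rewrite f2 g2 f1.
- by rewrite f3 g3.
Qed.

Definition cact_comp (X : category) (T : cartesian X) (A B C : change_action X)
    (g : cact_hom B C) (f : cact_hom A B) : cact_hom A C :=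
  CActHom (cact_comp_derP g f).

Lemma cact_comp_assoc (X : category) (T : cartesian X)
    (A B C D : change_action X) (h : cact_hom C D) (g : cact_hom B C)
    (f : cact_hom A B) :
  cact_comp h (cact_comp g f) = cact_comp (cact_comp h g) f.
Proof. by apply: cact_hom_eq => /=; cat_simp. Qed.

Lemma cact_comp_id_l (X : category) (T : cartesian X) (A B : change_action X)
    (f : cact_hom A B) : cact_comp (cact_id B) f = f.
Proof. by apply: cact_hom_eq => /=; cat_simp. Qed.

Lemma cact_comp_id_r (X : category) (T : cartesian X) (A B : change_action X)
    (f : cact_hom A B) : cact_comp f (cact_id A) = f.
Proof.
apply: cact_hom_eq => /=; cat_simp => //.
rewrite -[RHS]comp_id_r; congr (_ \o _).
by apply: pair_ext; cat_simp.
Qed.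

Definition CAct (X : category) {T : cartesian X} : category :=
  @Category (change_action X) (@cact_hom X T) (@cact_id X T) (@cact_comp X T)
    (@cact_comp_assoc X T) (@cact_comp_id_l X T) (@cact_comp_id_r X T).

Arguments CAct X {T}.

Section CActCartesian.
Context {X : category} {T : cartesian X}.
Implicit Types A B : change_action X.

Lemma plus_0lE A (C : X) (y : hom C (delta A)) :
  plus A \o <|zero A \o bang C, y|> = y.
Proof.
have := f_equal (fun h => h \o y) (plus_0l A).
by cat_simp.
Qed.

Lemma plus_0rE A (C : X) (y : hom C (delta A)) :
  plus A \o <|y, zero A \o bang C|> = y.
Proof.
have := f_equal (fun h => h \o y) (plus_0r A).
by cat_simp.
Qed.

Lemma plus_assocE A (C : X) (x y z : hom C (delta A)) :
  plus A \o <|x, plus A \o <|y, z|> |> = plus A \o <|plus A \o <|x, y|>, z|>.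
Proof.
have := f_equal (fun h => h \o <|x, <|y, z|> |>) (plus_assoc A).
by cat_simp.
Qed.

Lemma oplus_0E A (C : X) (x : hom C (base A)) :
  oplus A \o <|x, zero A \o bang C|> = x.
Proof.
have := f_equal (fun h => h \o x) (oplus_0 A).
by cat_simp.
Qed.

Lemma oplus_plusE A (C : X) (x : hom C (base A)) (y z : hom C (delta A)) :
  oplus A \o <|x, plus A \o <|y, z|> |> = oplus A \o <|oplus A \o <|x, y|>, z|>.
Proof.
have := f_equal (fun h => h \o <|x, <|y, z|> |>) (oplus_plus A).
by cat_simp.
Qed.

Definition cact_prod A B : change_action X.
Proof.
refine (@ChangeAction X T (base A ** base B) (delta A ** delta B)
  <|oplus A \o (proj0 _ _ >< proj0 _ _), oplus B \o (proj1 _ _ >< proj1 _ _)|>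
  <|plus A \o (proj0 _ _ >< proj0 _ _), plus B \o (proj1 _ _ >< proj1 _ _)|>
  <|zero A, zero B|> _ _ _ _ _).
all: abstract (apply: pair_ext; cat_simp;
  by rewrite ?(plus_0lE, plus_0rE, plus_assocE, oplus_0E, oplus_plusE)).
Defined.

Definition cact_term : change_action X.
Proof.
refine (@ChangeAction X T termo termo (bang _) (bang _) (idm _) _ _ _ _ _).
all: abstract exact: bang_eq.
Defined.

Definition cact_proj0 A B : cact_hom (cact_prod A B) A.
Proof.
refine (@CActHom X T (cact_prod A B) A (proj0 _ _) (proj0 _ _ \o proj1 _ _) _).
abstract by split=> * /=; cat_simp.
Defined.

Definition cact_proj1 A B : cact_hom (cact_prod A B) B.
Proof.
refine (@CActHom X T (cact_prod A B) B (proj1 _ _) (proj1 _ _ \o proj1 _ _) _).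
abstract by split=> * /=; cat_simp.
Defined.

Definition cact_pair C A B (f : cact_hom C A) (g : cact_hom C B) :
  cact_hom C (cact_prod A B).
Proof.
refine (@CActHom X T C (cact_prod A B)
  <|cact_map f, cact_map g|> <|cact_der f, cact_der g|> _).
abstract (case: f g => [f df [f1 f2 f3]] [g dg [g1 g2 g3]] /=;
  by split=> * /=; cat_simp; rewrite ?(f1, f2, f3, g1, g2, g3)).
Defined.

Definition cact_bang A : cact_hom A cact_term.
Proof.
refine (@CActHom X T A cact_term (bang _) (bang _) _).
abstract (split=> *; exact: bang_eq).
Defined.

#[export] Instance CAct_cartesian : cartesian (CAct X).
Proof.
refine (@Cartesian (CAct X) cact_prod cact_proj0 cact_proj1 cact_pair _ _ _
  cact_term cact_bang _).
- abstract by move=> C A B f g; apply: cact_hom_eq => /=; cat_simp.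
- abstract by move=> C A B f g; apply: cact_hom_eq => /=; cat_simp.
- abstract by move=> C A B h; apply: cact_hom_eq; apply: pair_ext => /=; cat_simp.
- abstract by move=> A h; apply: cact_hom_eq; exact: bang_eq.
Defined.

End CActCartesian.

Definition forget (X : category) {T : cartesian X} : functor (CAct X) X :=
  @Functor (CAct X) X (fun A : change_action X => base A)
    (fun (A B : change_action X) (f : cact_hom A B) => cact_map f)
    (fun A => eq_refl) (fun A B C g f => eq_refl).

Arguments forget X {T}.

Record change_action_model (X : category) {T : cartesian X} := ChangeActionModel {
  alpha :> functor X (CAct X);
  alpha_prod : preserves_products T CAct_cartesian alpha;
  alpha_section : functor_eq (comp_functor (forget X) alpha) (id_functor X) }.

Arguments change_action_model X {T}.

(* The components of [alpha A] and [alpha f], with [base (alpha A)] replaced by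
   [A] along the equality of objects [alpha_section]. *)
Section Model.
Context {X : category} {T : cartesian X} (M : change_action_model X).

Definition base_alpha (A : X) : base (alpha M A) = A :=
  functor_eq_ob (alpha_section M) A.

Definition Delta (A : X) : X := delta (alpha M A).

Definition moplus (A : X) : hom (A ** Delta A) A :=
  hom_cast (f_equal (fun Z => Z ** Delta A) (base_alpha A)) (base_alpha A)
    (oplus (alpha M A)).

Definition mplus (A : X) : hom (Delta A ** Delta A) (Delta A) := plus (alpha M A).

Definition mzero (A : X) : hom termo (Delta A) := zero (alpha M A).

Definition mderiv (A B : X) (f : hom A B) : hom (A ** Delta A) (Delta B) :=
  hom_cast (f_equal (fun Z => Z ** Delta A) (base_alpha A)) eq_refl
    (cact_der (fmap (alpha M) f)).

(* The same maps read through an identification [Delta A = A]. *)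
Definition foplus (A : X) (e : Delta A = A) : hom (A ** A) A :=
  hom_cast (f_equal (prodo A) e) eq_refl (moplus A).

Definition fplus (A : X) (e : Delta A = A) : hom (A ** A) A :=
  hom_cast (f_equal2 prodo e e) e (mplus A).

Definition fzero (A : X) (e : Delta A = A) : hom termo A :=
  hom_cast eq_refl e (mzero A).

Definition fderiv (A B : X) (eA : Delta A = A) (eB : Delta B = B) (f : hom A B) :
    hom (A ** A) B :=
  hom_cast (f_equal (prodo A) eA) eB (mderiv f).

(* In [F2], only the second components are constrained: the first component of
   [alpha f] is [f] by [alpha_section]. *)
Record flat_object (A : X) : Prop := FlatObject {
  F1 : Delta A = A;
  F2_oplus : arr_eq (mderiv (foplus F1)) (foplus F1 \o proj1 (A ** A) (A ** A));
  F2_plus : arr_eq (mderiv (fplus F1)) (fplus F1 \o proj1 (A ** A) (A ** A));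
  F3 : forall (C : X) (f g h : hom C A),
    foplus F1 \o <|f, g|> = foplus F1 \o <|f, h|> -> g = h }.

Definition flat_map (A B : X) (FA : flat_object A) (FB : flat_object B)
    (f : hom A B) : Prop :=
  forall (C : X) (x y : hom C A),
    foplus (F1 FB) \o <|fzero (F1 FB) \o bang C,
                        fderiv (F1 FA) (F1 FB) f \o <|x, y|> |>
    = fderiv (F1 FA) (F1 FB) f
        \o <|x, foplus (F1 FA) \o <|fzero (F1 FA) \o bang C, y|> |>.

End Model.

Record is_subcategory (X : category) (P : X -> Prop)
    (Q : forall A B : X, P A -> P B -> hom A B -> Prop) : Prop := IsSubcategory {
  sub_id : forall (A : X) (pA : P A), Q A A pA pA (idm A);
  sub_comp : forall (A B C : X) (pA : P A) (pB : P B) (pC : P C)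
    (g : hom B C) (f : hom A B),
    Q B C pB pC g -> Q A B pA pB f -> Q A C pA pC (g \o f) }.

Section Subcategory.
Context {X : category} {P : X -> Prop}.
Context {Q : forall A B : X, P A -> P B -> hom A B -> Prop}.

Definition sub_hom (A B : {A : X | P A}) : Type :=
  {f : hom (proj1_sig A) (proj1_sig B) | Q (proj2_sig A) (proj2_sig B) f}.

Lemma sub_hom_eq (A B : {A : X | P A}) (f g : sub_hom A B) :
  proj1_sig f = proj1_sig g -> f = g.
Proof.
case: f g => [f Hf] [g Hg] /= e; subst g.
by rewrite (proof_irrelevance _ Hf Hg).
Qed.

Definition subcategory (S : is_subcategory Q) : category.
Proof.
refine (@Category {A : X | P A} sub_hom
  (fun A => exist _ (idm (proj1_sig A)) (sub_id S (proj2_sig A)))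
  (fun A B C g f => exist _ (proj1_sig g \o proj1_sig f)
    (sub_comp S (proj2_sig g) (proj2_sig f))) _ _ _).
- abstract by move=> *; apply: sub_hom_eq; apply: comp_assoc.
- abstract by move=> *; apply: sub_hom_eq; apply: comp_id_l.
- abstract by move=> *; apply: sub_hom_eq; apply: comp_id_r.
Defined.

Definition inclusion (S : is_subcategory Q) : functor (subcategory S) X :=
  @Functor (subcategory S) X (fun A : {A : X | P A} => proj1_sig A)
    (fun (A B : {A : X | P A}) (f : sub_hom A B) => proj1_sig f)
    (fun A => eq_refl) (fun A B C g f => eq_refl).

End Subcategory.

Class left_additive (Y : category) := LeftAdditive {
  addm : forall A B : Y, hom A B -> hom A B -> hom A B;
  zerom : forall A B : Y, hom A B;
  addmA : forall A B (f g h : hom A B), addm f (addm g h) = addm (addm f g) h;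
  addmC : forall A B (f g : hom A B), addm f g = addm g f;
  add0m : forall A B (f : hom A B), addm (zerom A B) f = f;
  addm_comp : forall A B C (f g : hom B C) (h : hom A B),
    addm f g \o h = addm (f \o h) (g \o h);
  zerom_comp : forall A B C (h : hom A B), zerom B C \o h = zerom A C }.

Arguments addm {Y _ A B} f g : rename.
Arguments zerom {Y _ A B} : rename.

Notation "f + g" := (addm f g) : cat_scope.
Notation "0" := zerom : cat_scope.

Definition additive (Y : category) {L : left_additive Y} (A B : Y)
    (k : hom A B) : Prop :=
  (forall (C : Y) (f g : hom C A), k \o (f + g) = (k \o f) + (k \o g)) /\
  (forall C : Y, k \o (0 : hom C A) = 0).

Class cartesian_left_additive (Y : category) := CartesianLeftAdditive {
  cla_cartesian :: cartesian Y;
  cla_left_additive :: left_additive Y;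
  proj0_additive : forall A B : Y, additive (proj0 A B);
  proj1_additive : forall A B : Y, additive (proj1 A B) }.

Class infinitesimal_extension (Y : category) {L : cartesian_left_additive Y} :=
  InfinitesimalExtension {
  eps : forall A B : Y, hom A B -> hom A B;
  E1_add : forall (A B : Y) (f g : hom A B), eps (f + g) = eps f + eps g;
  E1_zero : forall A B : Y, eps (0 : hom A B) = 0;
  E2 : forall (A B C : Y) (g : hom B C) (f : hom A B), eps (g \o f) = eps g \o f;
  E3_proj0 : forall A B : Y, eps (proj0 A B) = proj0 A B \o eps (idm (A ** B));
  E3_proj1 : forall A B : Y, eps (proj1 A B) = proj1 A B \o eps (idm (A ** B)) }.

Arguments infinitesimal_extension Y {L}.
Arguments eps {Y L _ A B} f : rename.

Class cartesian_difference (Y : category) := CartesianDifference {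
  cd_cartesian_left_additive :: cartesian_left_additive Y;
  cd_infinitesimal_extension :: infinitesimal_extension Y;
  diff : forall A B : Y, hom A B -> hom (A ** A) B;
  Cd0 : forall (A B C : Y) (f : hom A B) (x y : hom C A),
    f \o (x + eps y) = (f \o x) + eps (diff f \o <|x, y|>);
  Cd1_add : forall (A B : Y) (f g : hom A B), diff (f + g) = diff f + diff g;
  Cd1_zero : forall A B : Y, diff (0 : hom A B) = 0;
  Cd1_eps : forall (A B : Y) (f : hom A B), diff (eps f) = eps (diff f);
  Cd2_add : forall (A B C : Y) (f : hom A B) (x y z : hom C A),
    diff f \o <|x, y + z|>
    = (diff f \o <|x, y|>) + (diff f \o <|x + eps y, z|>);
  Cd2_zero : forall (A B C : Y) (f : hom A B) (x : hom C A),
    diff f \o <|x, 0|> = 0;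
  Cd3_id : forall A : Y, diff (idm A) = proj1 A A;
  Cd3_proj0 : forall A B : Y,
    diff (proj0 A B) = proj0 A B \o proj1 (A ** B) (A ** B);
  Cd3_proj1 : forall A B : Y,
    diff (proj1 A B) = proj1 A B \o proj1 (A ** B) (A ** B);
  Cd4 : forall (A B C : Y) (f : hom A B) (g : hom A C),
    diff <|f, g|> = <|diff f, diff g|>;
  Cd5 : forall (A B C : Y) (g : hom B C) (f : hom A B),
    diff (g \o f) = diff g \o <|f \o proj0 A A, diff f|>;
  Cd6 : forall (A B C : Y) (f : hom A B) (x y z : hom C A),
    diff (diff f) \o <| <|x, y|>, <|0, z|> |> = diff f \o <|x + eps y, z|>;
  Cd7 : forall (A B C : Y) (f : hom A B) (x y z : hom C A),
    diff (diff f) \o <| <|x, y|>, <|z, 0|> |>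
    = diff (diff f) \o <| <|x, z|>, <|y, 0|> |> }.

Arguments diff {Y _ A B} f : rename.

(* Main.v *)
(* Write [x (+) y] for the action and [inf y = 0 (+) y].  Flatness of an object
   says that [(+)] and [+] are linear, so the derivative laws applied to them
   give interchange laws: [+] with itself (whence commutativity, by
   Eckmann-Hilton) and [+] with [(+)] (whence [x (+) y = x + inf y]).
   Right-injectivity of [(+)] then makes [+] cancellative.  The first-order
   axioms are read off the chain rule.  For the second-order ones, apply CAD1 to
   [df] at [<x, y> (+) <z, w>] and expand [df <x, y + (z (+) w)>] by CAD2 in both
   orders; cancellation yields
     df <x, y> (+) ddf <<x, y>, <z, w>> = df <x (+) z, y (+) w>,
     df <x, z> (+) ddf <<x, y>, <z, w>> = df <x (+) y, z (+) w>,
   and injectivity turns these into Cd6, Cd7 and the flatness of [df]. *)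
From Stdlib Require Import ssreflect ProofIrrelevance.
Require Import Defs.

Set Implicit Arguments.
Unset Strict Implicit.
Unset Printing Implicit Defensive.

Local Open Scope cat_scope.

(** * Casts along equalities of objects *)

Local Arguments hom_cast : simpl never.

(* Needed even for casts along [f_equal2 prodo eq_refl eq_refl], which is stuck
   because [f_equal2] is opaque. *)
Lemma hom_cast_refl (X : category) (A B : X) (eA : A = A) (eB : B = B)
    (f : hom A B) : hom_cast eA eB f = f.
Proof.
by rewrite (proof_irrelevance _ eA eq_refl) (proof_irrelevance _ eB eq_refl).
Qed.

Lemma arr_eq_cast (X : category) (A B A' B' : X) (f : hom A B) (g : hom A' B')
    (eA : A = A') (eB : B = B') : arr_eq f g -> hom_cast eA eB f = g.
Proof. by move=> H; case: _ _ _ / H eA eB => eA eB; rewrite hom_cast_refl. Qed.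

Lemma cast_arr_eq (X : category) (A B A' B' : X) (f : hom A B)
    (eA : A = A') (eB : B = B') : arr_eq (hom_cast eA eB f) f.
Proof. by case: _ / eA; case: _ / eB. Qed.

Lemma arr_eq_sym (X : category) (A B A' B' : X) (f : hom A B) (g : hom A' B') :
  arr_eq f g -> arr_eq g f.
Proof. by case. Qed.

Lemma arr_eq_trans (X : category) (A B A' B' A'' B'' : X) (f : hom A B)
    (g : hom A' B') (h : hom A'' B'') : arr_eq f g -> arr_eq g h -> arr_eq f h.
Proof. by case. Qed.

(** * Transport of change actions to a single underlying object *)

Section Recast.
Context {X : category} {T : cartesian X}.
Implicit Types (c : change_action X) (A : X).

(** The casts are nested exactly as in [foplus], [fplus] and [fzero], so that for [c = alpha M A]
    the three operations are convertible to these and every law of change actions applies to them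
    directly. *)
Definition recast c A (eb : base c = A) (ed : delta c = A) : change_action X.
Proof.
refine (@ChangeAction X T A A
  (hom_cast (f_equal (prodo A) ed) eq_refl
    (hom_cast (f_equal (fun Z => Z ** delta c) eb) eb (oplus c)))
  (hom_cast (f_equal2 prodo ed ed) ed (plus c))
  (hom_cast eq_refl ed (zero c)) _ _ _ _ _).
(* Opening [c] turns [base c] and [delta c] into variables, so [subst] can identify both with [A]
   and every cast becomes trivial. The later transport lemmas follow the same scheme. *)
all: abstract (by case: c eb ed => b d o p z ? ? ? ? ? /= eb ed; subst b d;
  rewrite !hom_cast_refl).
Defined.

Section Der.
Context {c1 c2 : change_action X} {A B : X}.
Context (eb1 : base c1 = A) (ed1 : delta c1 = A).
Context (eb2 : base c2 = B) (ed2 : delta c2 = B).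

(** The nesting of casts matches that of [fderiv] over [mderiv]. *)
Definition recast_der (h : cact_hom c1 c2) : hom (A ** A) B :=
  hom_cast (f_equal (prodo A) ed1) ed2
    (hom_cast (f_equal (fun Z => Z ** delta c1) eb1) eq_refl (cact_der h)).

Lemma recast_derP (h : cact_hom c1 c2) :
  is_derivative (A := recast eb1 ed1) (B := recast eb2 ed2)
    (hom_cast eb1 eb2 (cact_map h)) (recast_der h).
Proof.
rewrite /recast_der.
case: c1 eb1 ed1 h => b1 d1 o1 p1 z1 ? ? ? ? ? /= eb ed.
case: c2 eb2 ed2 => b2 d2 o2 p2 z2 ? ? ? ? ? /= eb' ed'.
subst b1 d1 b2 d2 => h; rewrite !hom_cast_refl.
case: (cact_derP h) => /= h1 h2 h3.
by split=> /= *; rewrite !hom_cast_refl.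
Qed.

End Der.

Lemma recast_der_id c A (eb : base c = A) (ed : delta c = A) :
  recast_der eb ed ed (cact_id c) = proj1 A A.
Proof.
rewrite /recast_der.
by case: c eb ed => b d o p z ? ? ? ? ? /= eb ed; subst b d;
  rewrite !hom_cast_refl.
Qed.

Lemma recast_der_comp c1 c2 c3 A1 A2 A3
    (eb1 : base c1 = A1) (ed1 : delta c1 = A1)
    (eb2 : base c2 = A2) (ed2 : delta c2 = A2)
    (ed3 : delta c3 = A3)
    (g : cact_hom c2 c3) (f : cact_hom c1 c2) :
  recast_der eb1 ed1 ed3 (cact_comp g f)
  = recast_der eb2 ed2 ed3 g
      \o <|hom_cast eb1 eb2 (cact_map f) \o proj0 A1 A1,
           recast_der eb1 ed1 ed2 f|>.
Proof.
rewrite /recast_der.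
case: c1 eb1 ed1 f => b1 d1 o1 p1 z1 ? ? ? ? ? /= eb1 ed1.
case: c2 eb2 ed2 g => b2 d2 o2 p2 z2 ? ? ? ? ? /= eb2 ed2.
case: c3 ed3 => b3 d3 o3 p3 z3 ? ? ? ? ? /= ed3.
subst b1 d1 b2 d2 d3 => g; by rewrite !hom_cast_refl.
Qed.

Section Prod.
Context {c1 c2 c : change_action X} {A B : X}.
Context (eb1 : base c1 = A) (ed1 : delta c1 = A).
Context (eb2 : base c2 = B) (ed2 : delta c2 = B).
Context (eb : base c = A ** B) (ed : delta c = A ** B).

(** [c] stands for [alpha M (A ** B)], which is a product of change actions only up to a
    propositional equality. After substitution [eb] and [ed] are loops on [A ** B], removed by proof
    irrelevance. *)
Lemma oplus_recast_prod : c = cact_prod c1 c2 ->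
  oplus (recast eb ed)
  = oplus (cact_prod (recast eb1 ed1) (recast eb2 ed2)) :>
    hom ((A ** B) ** (A ** B)) (A ** B).
Proof.
move=> ec; subst c.
case: c1 eb1 ed1 eb ed => b1 d1 o1 p1 z1 ? ? ? ? ? /= e1 e1'.
case: c2 eb2 ed2 => b2 d2 o2 p2 z2 ? ? ? ? ? /= e2 e2'.
by subst b1 d1 b2 d2 => eb' ed'; rewrite !hom_cast_refl.
Qed.

Lemma plus_recast_prod : c = cact_prod c1 c2 ->
  plus (recast eb ed)
  = plus (cact_prod (recast eb1 ed1) (recast eb2 ed2)) :>
    hom ((A ** B) ** (A ** B)) (A ** B).
Proof.
move=> ec; subst c.
case: c1 eb1 ed1 eb ed => b1 d1 o1 p1 z1 ? ? ? ? ? /= e1 e1'.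
case: c2 eb2 ed2 => b2 d2 o2 p2 z2 ? ? ? ? ? /= e2 e2'.
by subst b1 d1 b2 d2 => eb' ed'; rewrite !hom_cast_refl.
Qed.

Lemma zero_recast_prod : c = cact_prod c1 c2 ->
  zero (recast eb ed)
  = zero (cact_prod (recast eb1 ed1) (recast eb2 ed2)) :> hom termo (A ** B).
Proof.
move=> ec; subst c.
case: c1 eb1 ed1 eb ed => b1 d1 o1 p1 z1 ? ? ? ? ? /= e1 e1'.
case: c2 eb2 ed2 => b2 d2 o2 p2 z2 ? ? ? ? ? /= e2 e2'.
by subst b1 d1 b2 d2 => eb' ed'; rewrite !hom_cast_refl.
Qed.

Lemma recast_der_proj0 (h : cact_hom c c1) (ec : c = cact_prod c1 c2) :
  arr_eq (X := CAct X) h (cact_proj0 c1 c2) ->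
  recast_der eb ed ed1 h = proj0 A B \o proj1 (A ** B) (A ** B).
Proof.
subst c => eh.
have {eh}-> : h = cact_proj0 c1 c2.
  exact: (arr_eq_cast (X := CAct X) eq_refl eq_refl eh).
rewrite /recast_der.
case: c1 eb1 ed1 eb ed h => b1 d1 o1 p1 z1 ? ? ? ? ? /= e1 e1'.
case: c2 eb2 ed2 => b2 d2 o2 p2 z2 ? ? ? ? ? /= e2 e2'.
subst b1 d1 b2 d2 => eb' ed'.
by rewrite !hom_cast_refl.
Qed.

Lemma recast_der_proj1 (h : cact_hom c c2) (ec : c = cact_prod c1 c2) :
  arr_eq (X := CAct X) h (cact_proj1 c1 c2) ->
  recast_der eb ed ed2 h = proj1 A B \o proj1 (A ** B) (A ** B).
Proof.
subst c => eh.
have {eh}-> : h = cact_proj1 c1 c2.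
  exact: (arr_eq_cast (X := CAct X) eq_refl eq_refl eh).
rewrite /recast_der.
case: c1 eb1 ed1 eb ed => b1 d1 o1 p1 z1 ? ? ? ? ? /= e1 e1'.
case: c2 eb2 ed2 h => b2 d2 o2 p2 z2 ? ? ? ? ? /= e2 e2' h.
subst b1 d1 b2 d2 => eb' ed'.
by rewrite !hom_cast_refl.
Qed.

End Prod.
End Recast.

(** * Calculus on objects satisfying F.1 *)

Section SelfDelta.
Context {X : category} {T : cartesian X} (M : change_action_model X).
Implicit Types A B C : X.
Notation self A := (Delta M A = A).

Definition fact A (e : self A) : change_action X :=
  recast (base_alpha M A) e.

Lemma alpha_map A B (f : hom A B) :
  hom_cast (base_alpha M A) (base_alpha M B) (cact_map (fmap (alpha M) f)) = f.
Proof. exact: arr_eq_cast (functor_eq_map (alpha_section M) f). Qed.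

Lemma fderivP A B (eA : self A) (eB : self B) (f : hom A B) :
  is_derivative (A := fact eA) (B := fact eB) f (fderiv eA eB f).
Proof.
have := recast_derP (base_alpha M A) eA (base_alpha M B) eB (fmap (alpha M) f).
by rewrite alpha_map.
Qed.

Lemma fderiv_id A (e : self A) : fderiv e e (idm A) = proj1 A A.
Proof.
rewrite -(recast_der_id (base_alpha M A) e).
by rewrite /fderiv /mderiv fmap_id.
Qed.

Lemma fderiv_comp A B C (eA : self A) (eB : self B) (eC : self C)
    (g : hom B C) (f : hom A B) :
  fderiv eA eC (g \o f)
  = fderiv eB eC g \o <|f \o proj0 A A, fderiv eA eB f|>.
Proof.
have := recast_der_comp (base_alpha M A) eA (base_alpha M B) eB
  eC (fmap (alpha M) g) (fmap (alpha M) f).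
by rewrite alpha_map /fderiv /mderiv fmap_comp.
Qed.

Lemma self_prod A B : self A -> self B -> self (A ** B).
Proof.
by move=> eA eB; rewrite /Delta (preserves_prodo (alpha_prod M)); congr prodo.
Qed.

Lemma self_term : self termo.
Proof. by rewrite /Delta (preserves_termo (alpha_prod M)). Qed.

Lemma fderiv_proj0 A B (eA : self A) (eB : self B) (e : self (A ** B)) :
  fderiv e eA (proj0 A B) = proj0 A B \o proj1 (A ** B) (A ** B).
Proof.
exact: (recast_der_proj0 (base_alpha M A) eA (base_alpha M B) eB _ _
  (preserves_prodo (alpha_prod M) A B) (preserves_proj0 (alpha_prod M) A B)).
Qed.

Lemma fderiv_proj1 A B (eA : self A) (eB : self B) (e : self (A ** B)) :
  fderiv e eB (proj1 A B) = proj1 A B \o proj1 (A ** B) (A ** B).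
Proof.
exact: (recast_der_proj1 (base_alpha M A) eA (base_alpha M B) eB _ _
  (preserves_prodo (alpha_prod M) A B) (preserves_proj1 (alpha_prod M) A B)).
Qed.

Lemma fderiv_proj0_comp A B C (eA : self A) (eB : self B) (eC : self C)
    (e : self (A ** B)) (h : hom C (A ** B)) :
  fderiv eC eA (proj0 A B \o h) = proj0 A B \o fderiv eC e h.
Proof. by rewrite (fderiv_comp eC e) (fderiv_proj0 _ eB); cat_simp. Qed.

Lemma fderiv_proj1_comp A B C (eA : self A) (eB : self B) (eC : self C)
    (e : self (A ** B)) (h : hom C (A ** B)) :
  fderiv eC eB (proj1 A B \o h) = proj1 A B \o fderiv eC e h.
Proof. by rewrite (fderiv_comp eC e) (fderiv_proj1 eA); cat_simp. Qed.

(** Only the projections are assumed to be preserved by [alpha]. The chain rule with their known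
    derivatives determines both components. *)
Lemma fderiv_pair A B C (eA : self A) (eB : self B) (eC : self C)
    (e : self (A ** B)) (f : hom C A) (g : hom C B) :
  fderiv eC e <|f, g|> = <|fderiv eC eA f, fderiv eC eB g|>.
Proof.
apply: pair_ext; cat_simp.
- by rewrite -(fderiv_proj0_comp eA eB) proj0_pair.
- by rewrite -(fderiv_proj1_comp eA eB) proj1_pair.
Qed.

(** Operations on generalised elements [C -> A], in which the rest of the proof is carried out. *)
Definition act A (e : self A) C (x y : hom C A) : hom C A :=
  foplus e \o <|x, y|>.
Definition add A (e : self A) C (x y : hom C A) : hom C A :=
  fplus e \o <|x, y|>.
Definition nul A (e : self A) C : hom C A := fzero e \o bang C.

Lemma act_comp A (e : self A) C D (x y : hom C A) (h : hom D C) :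
  act e x y \o h = act e (x \o h) (y \o h).
Proof. by rewrite /act -comp_assoc pair_comp. Qed.

Lemma add_comp A (e : self A) C D (x y : hom C A) (h : hom D C) :
  add e x y \o h = add e (x \o h) (y \o h).
Proof. by rewrite /add -comp_assoc pair_comp. Qed.

Lemma nul_comp A (e : self A) C D (h : hom D C) : nul e C \o h = nul e D.
Proof. by rewrite /nul -comp_assoc bang_comp. Qed.

Section Laws.
Context {A : X} (e : self A) {C : X}.
Implicit Types x y z : hom C A.

Lemma add_nul_l x : add e (nul e C) x = x.
Proof. exact: (plus_0lE (A := fact e)). Qed.

Lemma add_nul_r x : add e x (nul e C) = x.
Proof. exact: (plus_0rE (A := fact e)). Qed.

Lemma add_assoc x y z : add e x (add e y z) = add e (add e x y) z.
Proof. exact: (plus_assocE (A := fact e)). Qed.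

Lemma act_nul x : act e x (nul e C) = x.
Proof. exact: (oplus_0E (A := fact e)). Qed.

Context {B : X} (eB : self B) (f : hom A B).

Lemma comp_act x y :
  f \o act e x y = act eB (f \o x) (fderiv e eB f \o <|x, y|>).
Proof. exact: (CAD1 (fderivP e eB f)). Qed.

Lemma fderiv_add_r x y z :
  fderiv e eB f \o <|x, add e y z|>
  = add eB (fderiv e eB f \o <|x, y|>) (fderiv e eB f \o <|act e x y, z|>).
Proof. exact: (CAD2_plus (fderivP e eB f)). Qed.

Lemma fderiv_nul_r x : fderiv e eB f \o <|x, nul e C|> = nul eB C.
Proof. exact: (CAD2_zero (fderivP e eB f)). Qed.

End Laws.

Section ProdLaws.
Context {A B : X} (eA : self A) (eB : self B) (e : self (A ** B)) {C : X}.

Lemma act_pair (x y : hom C A) (z w : hom C B) :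
  act e <|x, z|> <|y, w|> = <|act eA x y, act eB z w|>.
Proof.
rewrite /act.
have -> : foplus e = _ := oplus_recast_prod (base_alpha M A) eA (base_alpha M B)
  eB (base_alpha M _) e (preserves_prodo (alpha_prod M) A B).
by rewrite /=; cat_simp.
Qed.

Lemma add_pair (x y : hom C A) (z w : hom C B) :
  add e <|x, z|> <|y, w|> = <|add eA x y, add eB z w|>.
Proof.
rewrite /add.
have -> : fplus e = _ := plus_recast_prod (base_alpha M A) eA (base_alpha M B)
  eB (base_alpha M _) e (preserves_prodo (alpha_prod M) A B).
by rewrite /=; cat_simp.
Qed.

Lemma nul_pair : nul e C = <|nul eA C, nul eB C|>.
Proof.
rewrite /nul.
have -> : fzero e = _ := zero_recast_prod (base_alpha M A) eA (base_alpha M B)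
  eB (base_alpha M _) e (preserves_prodo (alpha_prod M) A B).
by rewrite /=; cat_simp.
Qed.

End ProdLaws.

(** The zero map is a point of [A] precomposed with [bang], so by the chain rule its derivative is
    that of the point along a zero increment. *)
Lemma fderiv_nul A C (eA : self A) (eC : self C) :
  fderiv eC eA (nul eA C) = nul eA (C ** C).
Proof.
rewrite /nul (fderiv_comp eC self_term).
(* The derivative of [bang] lands in [termo], hence equals the zero increment required by CAD2. *)
rewrite (bang_eq (fderiv _ _ _) (nul self_term (C ** C))).
by rewrite fderiv_nul_r.
Qed.

Lemma fderiv_arr_eq A B (eA : self A) (eB : self B) (f : hom A B) :
  arr_eq (fderiv eA eB f) (mderiv M f).
Proof. exact: cast_arr_eq. Qed.

End SelfDelta.

(** Rests on the irrelevance of equality proofs between objects. *)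
Lemma arr_eq_eq (X : category) (A B : X) (f g : hom A B) : arr_eq f g -> f = g.
Proof. exact: (arr_eq_cast eq_refl eq_refl). Qed.

(** * Algebra of a flat object *)

Section FlatObject.
Context {X : category} {T : cartesian X} {M : change_action_model X} {A : X}.
Context (F : flat_object M A).
Let e : Delta M A = A := F1 F.
Let e2 := self_prod e e.

Lemma fderiv_foplus :
  fderiv e2 e (foplus e) = foplus e \o proj1 (A ** A) (A ** A).
Proof. exact: arr_eq_eq (arr_eq_trans (fderiv_arr_eq _ _ _) (F2_oplus F)). Qed.

Lemma fderiv_fplus :
  fderiv e2 e (fplus e) = fplus e \o proj1 (A ** A) (A ** A).
Proof. exact: arr_eq_eq (arr_eq_trans (fderiv_arr_eq _ _ _) (F2_plus F)). Qed.

Lemma fderiv_act C (eC : Delta M C = C) (f g : hom C A) :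
  fderiv eC e (act e f g) = act e (fderiv eC e f) (fderiv eC e g).
Proof.
rewrite /act (fderiv_comp eC e2) fderiv_foplus (fderiv_pair e e).
by cat_simp.
Qed.

Lemma fderiv_add C (eC : Delta M C = C) (f g : hom C A) :
  fderiv eC e (add e f g) = add e (fderiv eC e f) (fderiv eC e g).
Proof.
rewrite /add (fderiv_comp eC e2) fderiv_fplus (fderiv_pair e e).
by cat_simp.
Qed.

Context {C : X}.
Implicit Types x y z : hom C A.

(** CAD1 for the map [+] at [<x, z> (+) <y, w>]: by F.2 its derivative is [+] on the increments. *)
Lemma add_act x y z w :
  add e (act e x y) (act e z w) = act e (add e x z) (add e y w).
Proof.
have := comp_act e2 e (fplus e) <|x, z|> <|y, w|>.
rewrite (act_pair e e) fderiv_fplus; cat_simp; exact.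
Qed.

Lemma add_add x y z w :
  add e (add e x y) (add e z w) = add e (add e x z) (add e y w).
Proof.
(* CAD2 for [+]. The base point [<x, z>] is arbitrary, since the derivative of [+] ignores it. *)
have := fderiv_add_r e2 e (fplus e) <|x, z|> <|x, z|> <|y, w|>.
rewrite (add_pair e e) fderiv_fplus; cat_simp; exact.
Qed.

Lemma add_comm x y : add e x y = add e y x.
Proof.
have := add_add (nul e C) x y (nul e C).
by rewrite !add_nul_l !add_nul_r.
Qed.

Definition inf x : hom C A := act e (nul e C) x.

(** Interchange merges [(x (+) 0) + (0 (+) y)] into [(x + 0) (+) (0 + y)]. *)
Lemma act_inf x y : act e x y = add e x (inf y).
Proof. by rewrite -{2}(act_nul e x) add_act add_nul_r add_nul_l. Qed.

Lemma inf_add x y : inf (add e x y) = add e (inf x) (inf y).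
Proof. by rewrite /inf add_act add_nul_l. Qed.

Lemma inf_nul : inf (nul e C) = nul e C.
Proof. exact: act_nul. Qed.

Lemma inf_act x y : inf (act e x y) = act e (inf x) (inf y).
Proof. by rewrite !act_inf inf_add. Qed.

(** Both sides are [x + y + inf z]. This symmetry is what allows the two expansions of a derivative
    compared in [act_dd_add]. *)
Lemma add_act_swap x y z : add e x (act e y z) = add e y (act e x z).
Proof. by rewrite !act_inf !add_assoc (add_comm x). Qed.

Lemma act_inj x y z : act e x y = act e x z -> y = z.
Proof. exact: (F3 (f0 := F)). Qed.

Lemma add_inj x y z : add e x y = add e x z -> y = z.
Proof.
(* With base point [inf x], the action [inf x (+) y] is [inf (x + y)], which depends on [x + y]
   alone. *)
by move=> h; apply: (act_inj (x := inf x)); rewrite !act_inf -!inf_add h.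
Qed.

End FlatObject.

(** * Closure of flat objects and flat maps under the structure *)

Section FlatClosure.
Context {X : category} {T : cartesian X} (M : change_action_model X).
Implicit Types A B C : X.
Notation flat A := (flat_object M A).
Notation D FA FB f := (fderiv (F1 FA) (F1 FB) f).

Lemma inf_comp A (FA : flat A) C E (x : hom C A) (h : hom E C) :
  inf FA x \o h = inf FA (x \o h).
Proof. by rewrite /inf act_comp nul_comp. Qed.

(** F.2 in terms of [fderiv], which makes it a plain equation that can be proved by rewriting. *)
Lemma flat_objectI A (e : Delta M A = A) (e2 : Delta M (A ** A) = A ** A) :
  fderiv e2 e (foplus e) = foplus e \o proj1 (A ** A) (A ** A) ->
  fderiv e2 e (fplus e) = fplus e \o proj1 (A ** A) (A ** A) ->
  (forall C (x y z : hom C A), act e x y = act e x z -> y = z) ->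
  flat A.
Proof.
move=> Ho Hp inj; apply: (@FlatObject X T M A e) => //.
- by rewrite -Ho; exact: arr_eq_sym (fderiv_arr_eq _ _ _).
- by rewrite -Hp; exact: arr_eq_sym (fderiv_arr_eq _ _ _).
Qed.

Lemma flat_prod A B : flat A -> flat B -> flat (A ** B).
Proof.
move=> FA FB; pose e := self_prod (F1 FA) (F1 FB).
have id_eta : idm ((A ** B) ** (A ** B)) = <|proj0 _ _, proj1 _ _|>.
  by apply: pair_ext; cat_simp.
apply: (flat_objectI (e := e) (e2 := self_prod e e)).
(* The action of the product is written as a pair of actions on projections, so that F.2 of each
   factor differentiates its own component. *)
- have -> : foplus e
      = <|act (F1 FA) (proj0 A B \o proj0 _ _) (proj0 A B \o proj1 _ _),
          act (F1 FB) (proj1 A B \o proj0 _ _) (proj1 A B \o proj1 _ _)|>.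
    by rewrite -(act_pair _ _ e) -!pair_unique /act -id_eta comp_id_r.
  rewrite (fderiv_pair (F1 FA) (F1 FB)) !fderiv_act.
  rewrite !(fderiv_proj0_comp (F1 FA) (F1 FB) _ e).
  rewrite !(fderiv_proj1_comp (F1 FA) (F1 FB) _ e).
  rewrite !(fderiv_proj0 e e) !(fderiv_proj1 e e).
  by rewrite pair_comp !act_comp; cat_simp.
- have -> : fplus e
      = <|add (F1 FA) (proj0 A B \o proj0 _ _) (proj0 A B \o proj1 _ _),
          add (F1 FB) (proj1 A B \o proj0 _ _) (proj1 A B \o proj1 _ _)|>.
    by rewrite -(add_pair _ _ e) -!pair_unique /add -id_eta comp_id_r.
  rewrite (fderiv_pair (F1 FA) (F1 FB)) !fderiv_add.
  rewrite !(fderiv_proj0_comp (F1 FA) (F1 FB) _ e).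
  rewrite !(fderiv_proj1_comp (F1 FA) (F1 FB) _ e).
  rewrite !(fderiv_proj0 e e) !(fderiv_proj1 e e).
  by rewrite pair_comp !add_comp; cat_simp.
(* Right-injectivity holds in each component separately. *)
- move=> C x y z.
  rewrite (pair_unique x) (pair_unique y) (pair_unique z).
  rewrite !(act_pair (F1 FA) (F1 FB)) => E.
  move: (f_equal (comp (proj0 A B)) E) (f_equal (comp (proj1 A B)) E).
  by rewrite !proj0_pair !proj1_pair => /act_inj -> /act_inj ->.
Qed.

Lemma flat_term : flat termo.
Proof.
pose e := self_term M.
by apply: (flat_objectI (e := e) (e2 := self_prod e e)) => *; exact: bang_eq.
Qed.

Lemma inf_pair A B (FA : flat A) (FB : flat B) (FAB : flat (A ** B)) C
    (x : hom C A) (y : hom C B) : inf FAB <|x, y|> = <|inf FA x, inf FB y|>.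
Proof.
by rewrite /inf (nul_pair (F1 FA) (F1 FB)) (act_pair (F1 FA) (F1 FB)).
Qed.

Lemma proj0_inf A B (FA : flat A) (FB : flat B) (FAB : flat (A ** B)) C
    (x : hom C (A ** B)) : proj0 A B \o inf FAB x = inf FA (proj0 A B \o x).
Proof. by rewrite {1}(pair_unique x) (inf_pair FA FB) proj0_pair. Qed.

Lemma proj1_inf A B (FA : flat A) (FB : flat B) (FAB : flat (A ** B)) C
    (x : hom C (A ** B)) : proj1 A B \o inf FAB x = inf FB (proj1 A B \o x).
Proof. by rewrite {1}(pair_unique x) (inf_pair FA FB) proj1_pair. Qed.

Lemma proj0_add A B (eA : Delta M A = A) (eB : Delta M B = B)
    (e : Delta M (A ** B) = A ** B) C (x y : hom C (A ** B)) :
  proj0 A B \o add e x y = add eA (proj0 A B \o x) (proj0 A B \o y).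
Proof.
by rewrite {1}(pair_unique x) {1}(pair_unique y) (add_pair eA eB) proj0_pair.
Qed.

Lemma proj1_add A B (eA : Delta M A = A) (eB : Delta M B = B)
    (e : Delta M (A ** B) = A ** B) C (x y : hom C (A ** B)) :
  proj1 A B \o add e x y = add eB (proj1 A B \o x) (proj1 A B \o y).
Proof.
by rewrite {1}(pair_unique x) {1}(pair_unique y) (add_pair eA eB) proj1_pair.
Qed.

Lemma proj0_nul A B (eA : Delta M A = A) (eB : Delta M B = B)
    (e : Delta M (A ** B) = A ** B) C : proj0 A B \o nul e C = nul eA C.
Proof. by rewrite (nul_pair eA eB) proj0_pair. Qed.

Lemma proj1_nul A B (eA : Delta M A = A) (eB : Delta M B = B)
    (e : Delta M (A ** B) = A ** B) C : proj1 A B \o nul e C = nul eB C.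
Proof. by rewrite (nul_pair eA eB) proj1_pair. Qed.

Lemma flat_mapP A B (FA : flat A) (FB : flat B) (f : hom A B) :
  flat_map FA FB f <-> forall C (x y : hom C A),
    inf FB (D FA FB f \o <|x, y|>) = D FA FB f \o <|x, inf FA y|>.
Proof. by []. Qed.

Lemma flat_id A (FA FA' : flat A) : flat_map FA FA' (idm A).
Proof.
rewrite (proof_irrelevance _ FA' FA).
by apply/flat_mapP => C x y; rewrite fderiv_id !proj1_pair.
Qed.

Lemma flat_comp A B C (FA : flat A) (FB : flat B) (FC : flat C)
    (g : hom B C) (f : hom A B) :
  flat_map FB FC g -> flat_map FA FB f -> flat_map FA FC (g \o f).
Proof.
move=> /flat_mapP Hg /flat_mapP Hf; apply/flat_mapP => E x y.
rewrite (fderiv_comp (F1 FA) (F1 FB)) -!comp_assoc !pair_comp.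
by rewrite Hg Hf -!comp_assoc !proj0_pair.
Qed.

Lemma flat_subcategory : is_subcategory (flat_map (M := M)).
Proof. by split=> *; [exact: flat_id | apply: flat_comp; eassumption]. Qed.

Lemma flat_proj0 A B (FA : flat A) (FB : flat B) (FAB : flat (A ** B)) :
  flat_map FAB FA (proj0 A B).
Proof.
apply/flat_mapP => C x y; rewrite (fderiv_proj0 (F1 FA) (F1 FB)).
by rewrite -!comp_assoc !proj1_pair (proj0_inf FA FB).
Qed.

Lemma flat_proj1 A B (FA : flat A) (FB : flat B) (FAB : flat (A ** B)) :
  flat_map FAB FB (proj1 A B).
Proof.
apply/flat_mapP => C x y; rewrite (fderiv_proj1 (F1 FA) (F1 FB)).
by rewrite -!comp_assoc !proj1_pair (proj1_inf FA FB).
Qed.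

Lemma flat_bang A (FA : flat A) (FT : flat termo) :
  flat_map FA FT (bang A).
Proof. by apply/flat_mapP => *; exact: bang_eq. Qed.

Lemma flat_pair A B C (FA : flat A) (FB : flat B) (FAB : flat (A ** B))
    (FC : flat C) (f : hom C A) (g : hom C B) :
  flat_map FC FA f -> flat_map FC FB g -> flat_map FC FAB <|f, g|>.
Proof.
move=> /flat_mapP Hf /flat_mapP Hg; apply/flat_mapP => E x y.
by rewrite (fderiv_pair (F1 FA) (F1 FB)) !pair_comp (inf_pair FA FB) Hf Hg.
Qed.

(** * Flatness of sums and of [inf], and second derivatives *)

Section Maps.
Context {A B : X} (FA : flat A) (FB : flat B).

Lemma flat_add (f g : hom A B) : flat_map FA FB f -> flat_map FA FB g ->
  flat_map FA FB (add (F1 FB) f g).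
Proof.
move=> /flat_mapP Hf /flat_mapP Hg; apply/flat_mapP => C x y.
by rewrite fderiv_add !add_comp inf_add Hf Hg.
Qed.

Lemma flat_nul : flat_map FA FB (nul (F1 FB) A).
Proof. by apply/flat_mapP => C x y; rewrite fderiv_nul !nul_comp inf_nul. Qed.

Lemma fderiv_inf C (FC : flat C) (f : hom C B) :
  D FC FB (inf FB f) = inf FB (D FC FB f).
Proof. by rewrite /inf fderiv_act fderiv_nul. Qed.

Lemma flat_inf (f : hom A B) : flat_map FA FB f -> flat_map FA FB (inf FB f).
Proof.
move=> /flat_mapP Hf; apply/flat_mapP => C x y.
by rewrite fderiv_inf !inf_comp Hf.
Qed.

Context {f : hom A B} (Hf : flat_map FA FB f) (FAA : flat (A ** A)) {C : X}.
Notation d := (D FA FB f).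
Notation dd := (D FAA FB d).
Notation nulA := (nul (F1 FA) C).
Notation "x [+] y" := (act (F1 FA) x y) (at level 50, left associativity).
Implicit Types x y z w : hom C A.

Lemma act_dd x y z w :
  act (F1 FB) (d \o <|x, y|>) (dd \o <| <|x, y|>, <|z, w|> |>)
  = d \o <|x [+] z, y [+] w|>.
Proof.
by rewrite -(comp_act (F1 FAA) (F1 FB)) (act_pair (F1 FA) (F1 FA)).
Qed.

(** CAD2 at the sum [y + inf z]. Flatness of [f] then moves [inf] out of the derivative, where it
    becomes an action again. *)
Lemma fderiv_act_r x y z :
  d \o <|x, y [+] z|> = act (F1 FB) (d \o <|x, y|>) (d \o <|x [+] y, z|>).
Proof. by rewrite (act_inf FA) fderiv_add_r -Hf -(act_inf FB). Qed.

Lemma dd_nul_l x y z :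
  dd \o <| <|x, y|>, <|nulA, z|> |> = d \o <|x [+] y, z|>.
Proof.
(* At this base point both sides become expansions of [d <x, y (+) z>]. *)
apply: (act_inj (F := FB) (x := d \o <|x, y|>)).
by rewrite act_dd act_nul fderiv_act_r.
Qed.

Lemma act_dd_add x y z w :
  act (F1 FB) (d \o <|x, z|>) (dd \o <| <|x, y|>, <|z, w|> |>)
  = d \o <|x [+] y, act (F1 FA) z w|>.
Proof.
apply: (add_inj (F := FB) (x := d \o <|x, y|>)).
(* The sum on the right is [d] at [x] along [y + (z (+) w) = z + (y (+) w)]. Splitting off [z] first
   gives [d <x, z> + d <x (+) z, y (+) w>], to which [act_dd] applies. *)
rewrite -fderiv_add_r (add_act_swap FA) fderiv_add_r -act_dd.
by rewrite (add_act_swap FB).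
Qed.

Lemma dd_swap x y z :
  dd \o <| <|x, y|>, <|z, nulA|> |> = dd \o <| <|x, z|>, <|y, nulA|> |>.
Proof.
(* Both sides then become [d <x (+) y, z>]: one by [act_dd_add], the other by [act_dd]. *)
apply: (act_inj (F := FB) (x := d \o <|x, z|>)).
by rewrite act_dd act_dd_add !act_nul.
Qed.

Lemma inf_dd x y z w :
  inf FB (dd \o <| <|x, y|>, <|z, w|> |>)
  = dd \o <| <|x, y|>, <|inf FA z, inf FA w|> |>.
Proof.
move/flat_mapP: (Hf) => Hf'.
(* By flatness this base point is also [d <x, inf z>], so [act_dd_add] applies at [z, w] on the left
   and at [inf z, inf w] on the right. *)
apply: (act_inj (F := FB) (x := inf FB (d \o <|x, z|>))).
by rewrite -inf_act act_dd_add !Hf' inf_act act_dd_add.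
Qed.

End Maps.

(** Makes the difference combinator well defined on the subcategory. *)
Lemma flat_fderiv A B (FA : flat A) (FB : flat B) (FAA : flat (A ** A))
    (f : hom A B) : flat_map FA FB f -> flat_map FAA FB (D FA FB f).
Proof.
move=> Hf; apply/flat_mapP => C x y.
rewrite (pair_unique x) (pair_unique y) (inf_pair FA FA).
exact: inf_dd.
Qed.

End FlatClosure.

(** * The Cartesian difference structure on flat objects and maps *)

Section Instances.
Context {X : category} {T : cartesian X} {M : change_action_model X}.
Context (S : is_subcategory (flat_map (M := M))).
Notation Flat := (subcategory S).

(** This and the following instances are transparent, so that [inclusion S] recovers the operations
    of [X] by conversion. *)
Definition flat_cartesian : cartesian Flat.
Proof.
refine (@Cartesian Flat
  (fun A B => exist _ (proj1_sig A ** proj1_sig B)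
     (flat_prod (proj2_sig A) (proj2_sig B)))
  (fun A B => exist _ (proj0 (proj1_sig A) (proj1_sig B)) 
     (flat_proj0 (proj2_sig A) (proj2_sig B) _))
  (fun A B => exist _ (proj1 (proj1_sig A) (proj1_sig B)) 
     (flat_proj1 (proj2_sig A) (proj2_sig B) _))
  (fun C A B f g => exist _ <|proj1_sig f, proj1_sig g|>
     (flat_pair _ (proj2_sig f) (proj2_sig g)))
  _ _ _
  (exist _ termo (flat_term M))
  (fun A => exist _ (bang (proj1_sig A)) (flat_bang _ _))
  _) => *; apply: sub_hom_eq.
- exact: proj0_pair.
- exact: proj1_pair.
- exact: pair_unique.
- exact: bang_unique.
Defined.

Definition flat_left_additive : left_additive Flat.
Proof.
refine (@LeftAdditive Flat
  (fun A B f g => exist _ (add (F1 (proj2_sig B)) (proj1_sig f) (proj1_sig g))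
     (flat_add (proj2_sig f) (proj2_sig g)))
  (fun A B => exist _ (nul (F1 (proj2_sig B)) (proj1_sig A)) (flat_nul _ _))
  _ _ _ _ _) => *; apply: sub_hom_eq.
- exact: add_assoc.
- exact: add_comm.
- exact: add_nul_l.
- exact: add_comp.
- exact: nul_comp.
Defined.

Definition flat_cla : cartesian_left_additive Flat.
Proof.
refine (@CartesianLeftAdditive Flat flat_cartesian flat_left_additive _ _)
  => A B; split=> *; apply: sub_hom_eq => /=.
- exact: proj0_add (F1 (proj2_sig A)) (F1 (proj2_sig B)) _ _ _ _.
- exact: proj0_nul (F1 (proj2_sig A)) (F1 (proj2_sig B)) _ _.
- exact: proj1_add (F1 (proj2_sig A)) (F1 (proj2_sig B)) _ _ _ _.
- exact: proj1_nul (F1 (proj2_sig A)) (F1 (proj2_sig B)) _ _.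
Defined.

Definition flat_infinitesimal_extension :
  @infinitesimal_extension Flat flat_cla.
Proof.
refine (@InfinitesimalExtension Flat flat_cla
  (fun A B f => exist _ (inf (proj2_sig B) (proj1_sig f))
     (flat_inf (proj2_sig f)))
  _ _ _ _ _) => A B *; apply: sub_hom_eq => /=.
- exact: inf_add.
- exact: inf_nul.
- by rewrite inf_comp.
- by rewrite (proj0_inf (proj2_sig A) (proj2_sig B)) comp_id_r.
- by rewrite (proj1_inf (proj2_sig A) (proj2_sig B)) comp_id_r.
Defined.

Definition flat_cartesian_difference : cartesian_difference Flat.
Proof.
refine (@CartesianDifference Flat flat_cla flat_infinitesimal_extension
  (fun A B f => exist _
     (fderiv (F1 (proj2_sig A)) (F1 (proj2_sig B)) (proj1_sig f))
     (flat_fderiv _ (proj2_sig f)))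
  _ _ _ _ _ _ _ _ _ _ _ _ _); intros; apply: sub_hom_eq => /=.
(* Reading [x + inf y] as [x (+) y] on both sides turns Cd0 into CAD1. *)
- by rewrite -!act_inf; exact: comp_act.
- exact: fderiv_add.
- exact: fderiv_nul.
- exact: fderiv_inf.
- by rewrite fderiv_add_r act_inf.
- exact: fderiv_nul_r.
- exact: fderiv_id.
- apply: fderiv_proj0; exact: F1 (proj2_sig _).
- apply: fderiv_proj1; exact: F1 (proj2_sig _).
- exact: fderiv_pair.
- exact: fderiv_comp.
- rewrite -act_inf; apply: dd_nul_l; exact: proj2_sig.
- apply: dd_swap; exact: proj2_sig.
Defined.

End Instances.

(* [inclusion S] preserving products says that the Cartesian structure of the
   subcategory is that of [X]. *)
Theorem proposition4p20 (X : category) (T : cartesian X)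
    (M : change_action_model X) :
  exists (S : is_subcategory (flat_map (M := M)))
         (D : cartesian_difference (subcategory S)),
    let I := inclusion S in
    preserves_products cla_cartesian T I /\
    (forall (A B : subcategory S) (f g : hom A B),
       fmap I (f + g)
       = fplus (F1 (proj2_sig B)) \o <|fmap I f, fmap I g|>) /\
    (forall A B : subcategory S,
       fmap I (0 : hom A B) = fzero (F1 (proj2_sig B)) \o bang (I A)) /\
    (forall (A B : subcategory S) (f : hom A B),
       fmap I (eps f)
       = foplus (F1 (proj2_sig B))
           \o <|fzero (F1 (proj2_sig B)) \o bang (I A), fmap I f|>) /\
    (forall (A B : subcategory S) (f : hom A B),
       arr_eq (fmap I (diff f)) (mderiv M (fmap I f))).
Proof.
exists (flat_subcategory M), (flat_cartesian_difference (flat_subcategory M)).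
split; first by split.
do 3 (split; first by []).
(* The combinator differs from the second component of [alpha f] by the casts along F.1 only. *)
by move=> A B f; exact: fderiv_arr_eq.
Qed.
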